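(* Let $c=\frac{1}{17}$. If $G$ is a connected graph of order $n$ with $\alpha(G)\,\omega(G)\le cn$, then $\min\{s^+(G),s^-(G)\}\ge n$.
   Context: All graphs are finite and simple. $\alpha(G)$ is the independence number and $\omega(G)$ the clique number of $G$. For a graph $G$ with adjacency eigenvalues $\lambda_i(G)$, $s^+(G)=\sum_{\lambda_i(G)>0}\lambda_i(G)^2$ and $s^-(G)=\sum_{\lambda_i(G)<0}\lambda_i(G)^2$. *)

(* Defs.v *)
From mathcomp Require Import all_boot all_order all_algebra.
From mathcomp Require Import polyrcf reals.

Set Implicit Arguments.
Unset Strict Implicit.
Unset Printing Implicit Defensive.

Import Order.TTheory GRing.Theory Num.Theory.
Local Open Scope ring_scope.

Record sgraph := SGraph {
  vertex :> finType;
  adj : rel vertex;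
  adj_sym : symmetric adj;
  adj_irrefl : irreflexive adj }.

Section Graphs.
Variable G : sgraph.

Definition connected_graph : Prop := forall x y : G, connect (@adj G) x y.

Definition independent (S : {set G}) : bool :=
  [forall x in S, forall y in S, ~~ adj x y].

Definition clique (S : {set G}) : bool :=
  [forall x in S, forall y in S, (x != y) ==> adj x y].

Definition independence_number : nat := (\max_(S | independent S) #|S|)%N.

Definition clique_number : nat := (\max_(S | clique S) #|S|)%N.

End Graphs.

Section Spectrum.
Variable R : realType.

Definition adjacency_mx (G : sgraph) : 'M[R]_#|G| :=
  \matrix_(i, j) (adj (enum_val i) (enum_val j))%:R.

(* The real eigenvalues, repeated with algebraic multiplicity.  A real
   symmetric matrix has only real eigenvalues, so nothing is lost for
   adjacency matrices. *)
Definition real_eigenvalues (n : nat) (A : 'M[R]_n) : seq R :=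
  flatten [seq nseq (mup x (char_poly A)) x | x <- rootsR (char_poly A)].

Definition adj_eigenvalues (G : sgraph) : seq R :=
  real_eigenvalues (adjacency_mx G).

Definition s_plus (G : sgraph) : R :=
  \sum_(l <- adj_eigenvalues G | 0 < l) l ^+ 2.

Definition s_minus (G : sgraph) : R :=
  \sum_(l <- adj_eigenvalues G | l < 0) l ^+ 2.

End Spectrum.

(* Main.v *)
Require Import Defs.
From mathcomp Require Import all_boot all_order all_algebra.
From mathcomp Require Import polyrcf reals.
From mathcomp Require Import complex ring lra.
Import Order.TTheory GRing.Theory Num.Theory.
Local Open Scope ring_scope.

(* Write A = A+ - A- with A+, A- positive semidefinite.  Then s^-(G) and s^+(G) are
   the squared Frobenius norms of A - A+ and A + A-, so it suffices to show
   ||A - sg M||^2 >= n for every positive semidefinite M and every sign sg.  Put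
   x_i = M_ii, z_i = max(0, 1 - x_i), u_i = max(0, x_i - 1).
   - Positivity of the 2x2 minors makes the error on an edge ij at least z_i z_j.
     With the diagonal terms x_i^2 and the Motzkin-Straus inequality
     z^T (A + I) z >= (sum z)^2 / alpha, half of the off-diagonal error already
     yields n - 2 alpha.
   - Positivity of the 3x3 minors shows that each induced path i - v - j carries a
     definite amount of error: the Gram vectors of i and j should both be parallel
     to that of v, yet orthogonal to each other.  Since few vertices are covered by
     alpha cliques, many induced paths can be packed disjointly; at most five of
     them share a centre v, so that a large x_v does not pay for them.  Together
     they force the other half of the error, plus 2 sum u, to be at least
     (245 / 3872) (n - alpha omega), and this is at least 2 alpha when
     n >= 17 alpha omega and omega >= 2. *)

(** * Greedy packings under a bound on the independence number *)

Section Packing.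
Context (G : sgraph).
Implicit Types (W S N : {set G}) (v : G) (a : nat).

Definition alpha_le W a : Prop :=
  forall S, S \subset W -> independent S -> (#|S| <= a)%N.

Definition closed_nbhd v : {set G} := v |: [set u | adj v u].

Lemma alpha_leW W1 W2 a : W1 \subset W2 -> alpha_le W2 a -> alpha_le W1 a.
Proof. by move=> s12 h S sS; apply: h; apply: subset_trans s12. Qed.

Lemma alpha_le_independence_number W : alpha_le W (independence_number G).
Proof. by move=> S _ iS; rewrite /independence_number leq_bigmax_cond. Qed.

(** Adding [v] to an independent set that avoids its closed neighbourhood keeps it independent. *)
Lemma alpha_le_remove_nbhd W v a :
  v \in W -> alpha_le W a -> (0 < a)%N /\ alpha_le (W :\: closed_nbhd v) a.-1.
Proof.
move=> vW h.
have iU S : S \subset W :\: closed_nbhd v -> independent S -> (#|S| < a)%N.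
  move=> sS iS.
  have nvS x : x \in S -> x != v /\ ~~ adj v x.
    by move=> /(subsetP sS); rewrite !inE negb_or => /andP[/andP[]].
  have vS : v \notin S by apply/negP=> /nvS[]; rewrite eqxx.
  have <- : #|v |: S| = #|S|.+1 by rewrite cardsU1 vS.
  apply: h.
    apply/subsetP=> x; rewrite !inE => /orP[/eqP->//|/(subsetP sS)].
    by rewrite inE => /andP[].
  apply/forallP=> x; apply/implyP; rewrite !inE => xvS.
  apply/forallP=> y; apply/implyP; rewrite !inE => yvS.
  move: xvS yvS => /orP[/eqP->|xS] /orP[/eqP->|yS].
  - by rewrite (@adj_irrefl G).
  - by case: (nvS y yS).
  - by rewrite (@adj_sym G); case: (nvS x xS).
  - by move/forallP/(_ x)/implyP/(_ xS)/forallP/(_ y)/implyP/(_ yS): iS.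
have a0 : (0 < a)%N.
  apply: leq_ltn_trans (iU set0 (sub0set _) _) => //.
  by apply/forallP=> x; rewrite inE.
by split=> // S sS iS; rewrite -ltnS prednK // iU.
Qed.

Context (R : realFieldType).

Section Greedy.
Variable z : G -> R.
Hypothesis z_ge0 : forall i, 0 <= z i.

(* Always delete the closed neighbourhood minimising its mass s: what is deleted
   contributes at most s * (2 - s) <= 1, and there are at most a deletions. *)
Lemma greedy_neighbourhood_bound W a : alpha_le W a ->
  \sum_(i in W) z i * (2 - (z i + \sum_(j | adj i j) z j)) <= a%:R.
Proof.
set s := fun i => z i + \sum_(j | adj i j) z j.
elim: a W => [|a IHa] W hW.
  case: (set_0Vmem W) => [->|[v vW]]; first by rewrite big_set0.
  by case: (alpha_le_remove_nbhd _ _ _ vW hW).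
case: (set_0Vmem W) => [->|[v0 v0W]]; first by rewrite big_set0 ler0n.
case: (arg_minP s v0W) => v vW vmin.
have [_ /= /IHa IH] := alpha_le_remove_nbhd _ _ _ vW hW.
rewrite (big_setID (closed_nbhd v)) /= -[a.+1%:R]nat1r; apply: lerD => //.
have s_ge0 : 0 <= s v by rewrite addr_ge0 ?sumr_ge0.
apply: (@le_trans _ _ ((\sum_(i in W :&: closed_nbhd v) z i) * (2 - s v))).
  rewrite mulr_suml; apply: ler_sum => i; rewrite inE => /andP[iW _].
  by apply: ler_wpM2l => //; have := vmin i iW; rewrite /s; lra.
have le_s : \sum_(i in W :&: closed_nbhd v) z i <= s v.
  apply: (@le_trans _ _ (\sum_(i in closed_nbhd v) z i)).
    by rewrite [leRHS](big_setID W) /= setIC lerDl sumr_ge0.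
  rewrite big_setU1 ?inE ?adj_irrefl //= /s lerD2l.
  by rewrite (eq_bigl (adj v)) // => j; rewrite inE.
have sum_ge0 : 0 <= \sum_(i in W :&: closed_nbhd v) z i by rewrite sumr_ge0.
move: le_s sum_ge0; set t := \sum_(i in _) _; move=> le_s t_ge0.
have [s2|/ltW s2] := lerP (s v) 2; last by nra.
have := sqr_ge0 (s v - 1); nra.
Qed.
End Greedy.

Lemma sum_setU (F : G -> R) (S W : {set G}) : [disjoint S & W] ->
  \sum_(i in S :|: W) F i = \sum_(i in S) F i + \sum_(i in W) F i.
Proof. by move=> dSW; rewrite -bigU //; apply: eq_bigl => i; rewrite !inE. Qed.

Section Cherries.
Variables (q : G -> G -> R) (kappa : R).
Hypothesis q_sym : forall i j, q i j = q j i.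
Hypothesis q_ge0 : forall i j, 0 <= q i j.
Hypothesis kappa_ge0 : 0 <= kappa.
Hypothesis cherry_weight : forall v i j,
  adj v i -> adj v j -> i != j -> ~~ adj i j ->
  kappa <= q v v / 5 + 2 * q v i + 2 * q v j + q i i + q j j + 2 * q i j.

Let Q W := \sum_(i in W) \sum_(j in W) q i j.

Let Q_ge0 W : 0 <= Q W.
Proof. by apply: sumr_ge0 => i _; apply: sumr_ge0. Qed.

Let QU S W : [disjoint S & W] ->
  Q (S :|: W) = Q S + Q W + 2 * \sum_(i in S) \sum_(j in W) q i j.
Proof.
move=> dSW.
rewrite /Q sum_setU // !(eq_bigr _ (fun i _ => sum_setU (q i) _ _ dSW)) !big_split /=.
rewrite [\sum_(i in W) \sum_(j in S) _]exchange_big /=.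
rewrite [X in _ + (X + _)](eq_bigr (fun i => \sum_(j in W) q i j)).
  ring.
by move=> i _; apply: eq_bigr.
Qed.

Let QUle S W : [disjoint S & W] -> Q S + Q W <= Q (S :|: W).
Proof.
move=> dSW; rewrite QU // lerDl mulr_ge0 //.
by apply: sumr_ge0 => i _; apply: sumr_ge0.
Qed.

Let Q1 v : Q [set v] = q v v.
Proof. by rewrite /Q !big_set1. Qed.

(** Pairs are split off greedily until there are [m] of them or a clique is left. Each pair is
    charged a fifth of [q v v], so up to five can share the centre. *)
Lemma nonadjacent_matching m v N : {in N, forall i, adj v i} ->
  exists S k, [/\ S \subset N, #|S| = k.*2, (k <= m)%N,
    k%:R * (kappa - q v v / 5) <= 2 * \sum_(i in S) q v i + Q S
    & k = m \/ clique (N :\: S)].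
Proof.
elim: m N => [|m IHm] N hN.
  exists set0, 0%N; split; rewrite ?sub0set ?cards0 //; last by left.
  by rewrite /Q !big_set0 mul0r mulr0 add0r.
have [cN|] := boolP (clique N).
  exists set0, 0%N; split; rewrite ?sub0set ?cards0 ?setD0 //; last by right.
  by rewrite /Q !big_set0 mul0r mulr0 add0r.
rewrite /clique negb_forall => /existsP; case=> i; rewrite negb_imply => /andP[iN].
rewrite negb_forall => /existsP[j]; rewrite !negb_imply => /andP[jN /andP[ij nij]].
have [] := IHm (N :\: [set i; j]).
  by move=> x; rewrite inE => /andP[_ /hN].
move=> S [k [sS cS km hS kS]].
have iS : [disjoint [set i; j] & S].
  rewrite disjoint_sym disjoints_subset; apply/subsetP=> x /(subsetP sS).
  by rewrite in_setD in_setC => /andP[].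
exists ([set i; j] :|: S), k.+1; split.
- rewrite subUset !subUset !sub1set iN jN /=; apply: subset_trans sS _.
  exact: subsetDl.
- by rewrite cardsU disjoint_setI0 // cards0 subn0 cards2 ij cS doubleS.
- by rewrite ltnS.
- rewrite sum_setU // -[k.+1%:R]natr1 mulrDl mul1r.
  have := QUle _ _ iS; rewrite big_setU1 ?inE //= big_set1.
  rewrite QU ?disjoints1 ?inE // !Q1 !big_set1.
  by have := cherry_weight v i j (hN i iN) (hN j jN) ij nij; lra.
- by case: kS => [->|]; [left | right; rewrite -setDDl].
Qed.

(* A spider is a vertex v together with disjoint nonadjacent pairs of its
   neighbours.  If five pairs exist, delete that spider (11 vertices, same a);
   otherwise delete the closed neighbourhood of v, which lowers a by one, and
   in which the unpaired neighbours form a clique together with v. *)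
Lemma cherry_packing W a : alpha_le W a ->
  5 * kappa * (#|W|%:R - (a * clique_number G)%:R) <= 11 * Q W.
Proof.
have [n] := ubnP #|W|; elim: n W a => // n IHn W a; rewrite ltnS => cW hW.
case: (set_0Vmem W) => [->|[v vW]].
  rewrite cards0 sub0r mulrN lerNl.
  apply: (@le_trans _ _ 0); first by rewrite oppr_le0 mulr_ge0.
  by rewrite !mulr_ge0.
(* [Q] is superadditive on disjoint sets, so it suffices that the deleted set pays for itself. *)
have shrink S b : S \subset W -> v \in S -> alpha_le (W :\: S) b ->
    5 * kappa * (#|W|%:R - #|S|%:R - (b * clique_number G)%:R) + 11 * Q S <= 11 * Q W.
  move=> sSW vS hb.
  have cWS : #|W| = (#|S| + #|W :\: S|)%N.
    by rewrite -(cardsID S W) (setIidPr sSW).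
  have S0 : (0 < #|S|)%N by apply/card_gt0P; exists v.
  have cD : (#|W :\: S| < n)%N.
    by apply: leq_trans cW; rewrite cWS -addn1 addnC leq_add2r.
  have dS : [disjoint S & W :\: S] by rewrite disjoint_sym disjoints_subset subsetDr.
  have := QUle _ _ dS; rewrite -{3}(setIidPr sSW) setID.
  have := IHn _ _ cD hb; rewrite cWS !natrD; lra.
have [S [k [sSN cS k5 hS kS]]] :=
  nonadjacent_matching 5 v (W :&: [set u | adj v u])
    (fun x => ltac:(by rewrite !inE => /andP[])).
set N := W :&: _ in sSN kS.
have vN : v \notin N by rewrite !inE adj_irrefl andbF.
have vS : v \notin S by apply: contra vN; apply: (subsetP sSN).
have sNW : N \subset W by apply: subsetIl.
have k5R : k%:R <= 5 :> R by rewrite (ler_nat _ _ 5).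
have spider : k%:R * kappa <= Q (v |: S).
  rewrite QU ?disjoints1 // Q1 big_set1.
  have : 0 <= q v v * (5 - k%:R) by rewrite mulr_ge0 // subr_ge0.
  lra.
(* With five pairs, weight [5 * kappa] pays for 11 vertices; this fixes the ratio in the
   statement. *)
case: kS => [k_eq|cl].
  have hb : alpha_le (W :\: (v |: S)) a by apply: alpha_leW hW; apply: subsetDl.
  have := shrink _ _ _ _ hb; rewrite subUset sub1set vW (subset_trans sSN) // setU11.
  have -> : #|v |: S| = 11%N by rewrite cardsU1 vS cS k_eq.
  by move=> /(_ isT isT); move: spider; rewrite k_eq; lra.
(* At most [2k + omega] vertices are deleted. Lowering [a] accounts for [omega] of them; the others
   need [10 k kappa], and [11 k kappa] is available. *)
have [a0 hb0] := alpha_le_remove_nbhd _ _ _ vW hW.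
have hb : alpha_le (W :\: (v |: N)) a.-1.
  apply: alpha_leW hb0; apply/subsetP => x; rewrite !inE.
  by case: (x \in W); rewrite ?andbF ?andbT.
have := shrink _ _ _ _ hb; rewrite subUset sub1set vW sNW setU11 => /(_ isT isT).
have cl_v : clique (v |: (N :\: S)).
  apply/forallP=> x; apply/implyP=> xv; apply/forallP=> y; apply/implyP=> yv.
  apply/implyP=> xy; have adj_v u : u \in N :\: S -> adj v u.
    by rewrite !inE => /and3P[].
  move: xv yv; rewrite !in_setU1 => /orP[/eqP xE|xN] /orP[/eqP yE|yN].
  - by rewrite xE yE eqxx in xy.
  - by rewrite xE adj_v.
  - by rewrite yE adj_sym adj_v.
  - by move/forallP/(_ x)/implyP/(_ xN)/forallP/(_ y)/implyP/(_ yN)/implyP/(_ xy): cl.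
have cardN : (#|v |: N| <= k.*2 + clique_number G)%N.
  rewrite cardsU1 vN -(cardsID S N) (setIidPr sSN) cS.
  have -> : (true + (k.*2 + #|N :\: S|) = k.*2 + #|v |: (N :\: S)|)%N.
    by rewrite cardsU1 in_setD vS (negbTE vN) addnCA.
  by rewrite leq_add2l /clique_number leq_bigmax_cond.
have mono : Q (v |: S) <= Q (v |: N).
  have sSN' : v |: S \subset v |: N by rewrite setUS.
  rewrite -(setID (v |: N) (v |: S)) (setIidPr sSN').
  apply: le_trans (QUle _ _ _); first by rewrite lerDl.
  by rewrite disjoint_sym disjoints_subset subsetDr.
move: cardN; rewrite -(ler_nat R) natrD -muln2 natrM => cardN.
have -> : (a * clique_number G)%:R = (a.-1 * clique_number G)%:R + (clique_number G)%:R :> R.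
  by rewrite -natrD -mulSnr prednK.
have : 0 <= kappa * (k%:R * 2 + (clique_number G)%:R - #|v |: N|%:R).
  by rewrite mulr_ge0 // subr_ge0.
have : 0 <= kappa * k%:R by rewrite mulr_ge0.
lra.
Qed.
End Cherries.
End Packing.

(** * Distance from the adjacency matrix to the semidefinite cones *)

Definition psd (R : numDomainType) (T : finType) (M : T -> T -> R) : Prop :=
  forall w : T -> R, 0 <= \sum_i \sum_j w i * w j * M i j.

(** The form is evaluated at [a e_v + b e_i + c e_j]. The vertices may coincide, so the 2x2
    conditions are covered too. *)
Lemma psd3 (R : realFieldType) (T : finType) (M : T -> T -> R) :
  (forall i j, M i j = M j i) -> psd R T M -> forall (v i j : T) (a b c : R),
  0 <= a ^+ 2 * M v v + b ^+ 2 * M i i + c ^+ 2 * M j j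
       + 2 * (a * b * M v i + a * c * M v j + b * c * M i j).
Proof.
move=> Msym Mpsd v i j a b c.
pose w x := a * (x == v)%:R + b * (x == i)%:R + c * (x == j)%:R.
have delta y (F : T -> R) : \sum_x (x == y)%:R * F x = F y.
  rewrite (bigD1 y) //= eqxx mul1r big1 ?addr0 // => x /negbTE ->.
  by rewrite mul0r.
have sum_w (F : T -> R) : \sum_x w x * F x = a * F v + b * F i + c * F j.
  rewrite /w -(delta v F) -(delta i F) -(delta j F) !mulr_sumr -!big_split /=.
  by apply: eq_bigr => x _; ring.
have := Mpsd w.
rewrite (eq_bigr (fun x => w x * (a * M x v + b * M x i + c * M x j))); last first.
  move=> x _; rewrite -(sum_w (M x)) mulr_sumr; apply: eq_bigr => y _; ring.
rewrite sum_w (Msym i v) (Msym j v) (Msym j i).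
by congr (0 <= _); ring.
Qed.

(* Here sg is a sign: the lemmas bound the distances from A to the positive
   (sg = 1) and negative (sg = -1) semidefinite cones together. *)
Section DistanceToPsd.
Context (R : realFieldType) (G : sgraph) (M : G -> G -> R) (sg : R).
Hypothesis M_sym : forall i j, M i j = M j i.
Hypothesis M_psd : psd R G M.
Hypothesis sg2 : sg ^+ 2 = 1.

Let z i := Num.max 0 (1 - M i i).
Let u i := Num.max 0 (M i i - 1).
Let err i j := ((adj i j)%:R - sg * M i j) ^+ 2.
(** Weights for the cherry packing: half of each off-diagonal error, and on the diagonal the excess
    [2 * u i] that [diag_bound] leaves over. *)
Let q i j := if i == j then 2 * u i else err i j / 2.

Let z_ge0 i : 0 <= z i. Proof. by rewrite le_max lexx. Qed.
Let u_ge0 i : 0 <= u i. Proof. by rewrite le_max lexx. Qed.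
Let u_ge i : M i i - 1 <= u i. Proof. by rewrite le_max lexx orbT. Qed.
Let err_ge0 i j : 0 <= err i j. Proof. exact: sqr_ge0. Qed.

Let diag_bound i : 1 - 2 * z i + z i ^+ 2 + 2 * u i <= M i i ^+ 2.
Proof.
rewrite /z /u; have := sqr_ge0 (M i i - 1).
by case: (lerP 0 (1 - M i i)); case: (lerP 0 (M i i - 1)) => ? ?; nra.
Qed.

(** [1 - sg * M i j] is at least the mean of [1 - M i i] and [1 - M j j]; when both are nonnegative,
    AM-GM concludes. *)
Let edge_bound i j : adj i j -> z i * z j <= err i j.
Proof.
move=> ij; have := psd3 R G M M_sym M_psd i i j 0 1 (- sg).
rewrite /err ij mulr1n sqrrN sg2; set t := sg * M i j => h.
have {}h : 2 * t <= M i i + M j j by move: h; rewrite /t; lra.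
rewrite /z; case: (lerP 0 (1 - M i i)) => hi; last by rewrite mul0r sqr_ge0.
case: (lerP 0 (1 - M j j)) => hj; last by rewrite mulr0 sqr_ge0.
have := sqr_ge0 (M i i - M j j).
set s := (1 - M i i + (1 - M j j)) / 2.
have : 0 <= (1 - t - s) * (1 - t + s) by rewrite /s mulr_ge0 //; lra.
rewrite /s; lra.
Qed.

(* The test vector (3/2, -sg, -sg) on (v, i, j): its three entries cannot all be
   close to 1 on the edges and 0 on the non-edge.  The value 49/352 is the squared
   distance of the origin to 3/2 * e1 + 3/2 * e2 + c = 7/8. *)
Let cherry_bound v i j : adj v i -> adj v j -> i != j -> ~~ adj i j ->
  49 / 352 <= q v v / 5 + 2 * q v i + 2 * q v j + q i i + q j j + 2 * q i j.
Proof.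
move=> vi vj ij nij.
have neq k : adj v k -> (v == k) = false.
  by move=> vk; apply/negP=> /eqP E; rewrite E adj_irrefl in vk.
rewrite /q !eqxx !neq // (negbTE ij) /err vi vj (negbTE nij) mulr1n mulr0n.
have := psd3 R G M M_sym M_psd v i j (3 / 2) (- sg) (- sg).
rewrite mulrNN -expr2 sqrrN sg2 sub0r sqrrN [(sg * M i j) ^+ 2]exprMn sg2 !mul1r.
set a := sg * M v i; set b := sg * M v j; set c := M i j.
have := u_ge v; have := u_ge i; have := u_ge j.
have := u_ge0 v; have := u_ge0 i; have := u_ge0 j.
(* The nearest point of that plane is [(21/88, 21/88, 7/44)]. An excess [u v] costs [63/176 * u v],
   which [q v v / 5 = 2/5 * u v] covers; a sixth of [q v v] would not. *)
have := sqr_ge0 (1 - a - 21 / 88); have := sqr_ge0 (1 - b - 21 / 88).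
have := sqr_ge0 (c - 7 / 44).
rewrite (_ : 3 / 2 * - sg * M v i = - (3 / 2) * a); last by rewrite /a; ring.
rewrite (_ : 3 / 2 * - sg * M v j = - (3 / 2) * b); last by rewrite /b; ring.
rewrite !sqrrB !expr1n; lra.
Qed.

Lemma dist_psd_ge : (1 < clique_number G)%N ->
  17 * (independence_number G * clique_number G)%:R <= #|G|%:R :> R ->
  #|G|%:R <= \sum_i \sum_j ((adj i j)%:R - sg * M i j) ^+ 2.
Proof.
move=> omega2 alpha_omega.
have q_sym i j : q i j = q j i.
  by rewrite /q eq_sym; case: eqP => [->|] //; rewrite /err adj_sym M_sym.
have q_ge0 i j : 0 <= q i j.
  by rewrite /q; case: ifP => _; [apply: mulr_ge0 | apply: divr_ge0].
have kappa_ge0 : 0 <= 49 / 352 :> R by lra.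
have := cherry_packing G R q _ q_sym q_ge0 kappa_ge0 cherry_bound setT _
  (alpha_le_independence_number G setT).
(* Applied to [z / 2], the greedy bound doubles to [sum (2 z_i - z_i (z_i + sum_(j ~ i) z_j) / 2) <=
   2 alpha], which uses only half of the edge errors. *)
have z2_ge0 i : 0 <= z i / 2 by rewrite divr_ge0.
have := greedy_neighbourhood_bound G R _ z2_ge0 setT _
  (alpha_le_independence_number G setT).
rewrite cardsT.
have sumT (F : G -> R) : \sum_(i in setT) F i = \sum_i F i.
  by apply: eq_bigl => i; rewrite inE.
set E := fun i => \sum_(j | j != i) err i j.
move=> hT hQ.
set T := \sum_(i in _) _ in hT; set Q := \sum_(i in _) _ in hQ.
have row i : z i * \sum_(j | adj i j) z j <= E i.
  rewrite mulr_sumr (le_trans (ler_sum _ (fun j => edge_bound i j))) //.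
  rewrite /E [leRHS](bigID (adj i)) /= [X in X + _](eq_bigl (adj i)).
    by rewrite lerDl sumr_ge0.
  by move=> j; case: eqP => [->|] //=; rewrite adj_irrefl.
have F_ge : #|G|%:R + Q - 2 * T <= \sum_i \sum_j err i j.
  have -> : #|G|%:R = \sum_(i : G) 1 :> R by rewrite sumr_const.
  rewrite /Q /T mulr_sumr !sumT -big_split -sumrB /=.
  apply: ler_sum => i _.
  have -> : \sum_(j in setT) q i j = 2 * u i + E i / 2.
    rewrite sumT (bigD1 i) //= /q eqxx /E mulr_suml; congr (_ + _).
    by apply: eq_bigr => j /negbTE; rewrite eq_sym => ->.
  have -> : \sum_j err i j = M i i ^+ 2 + E i.
    by rewrite (bigD1 i) //= {1}/err adj_irrefl sub0r sqrrN exprMn sg2 mul1r.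
  rewrite -mulr_suml; have := row i; have := diag_bound i.
  have := sqr_ge0 (z i); lra.
apply: le_trans F_ge.
(* Now [Q >= 245/3872 * 16 alpha omega >= 7840/3872 * alpha], just above [2 alpha]. *)
have : (independence_number G)%:R * 2 <= (independence_number G * clique_number G)%:R :> R.
  by rewrite -natrM ler_nat leq_mul2l omega2 orbT.
have : 0 <= (independence_number G)%:R :> R by [].
lra.
Qed.
End DistanceToPsd.

(** * Eigenvalues and semidefinite approximation of real symmetric matrices *)

Lemma perm_real_eigenvalues (R : realType) (n : nat) (A : 'M[R]_n) (s : seq R) :
  char_poly A = \prod_(x <- s) ('X - x%:P) -> perm_eq (real_eigenvalues A) s.
Proof.
move=> chiE; have chi0 : char_poly A != 0 by rewrite monic_neq0 ?char_poly_monic.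
rewrite /perm_eq; apply/allP => x _; apply/eqP => /=.
rewrite -(mu_prod_XsubC x s) -chiE /real_eigenvalues count_flatten -map_comp sumnE big_map.
rewrite (eq_bigr (fun y => if y == x then mup x (char_poly A) else 0%N)); last first.
  by move=> y _ /=; rewrite count_nseq /=; case: eqP => [->|]; rewrite ?mul1n ?mul0n.
rewrite -big_mkcond /= big_const_seq count_uniq_mem ?uniq_roots //.
have := roots_on_rootsR chi0 x; rewrite in_itv /= => <-.
by case: (boolP (root _ x)) => [_|/mupNroot->] //=; rewrite addn0.
Qed.

Lemma char_poly_conj (R : comNzRingType) (n : nat) (P Q B : 'M[R]_n) :
  Q *m P = 1%:M -> char_poly (Q *m B *m P) = char_poly B.
Proof.
move=> QP; rewrite /char_poly.
have QPp : map_mx polyC Q *m map_mx polyC P = 1%:M by rewrite -map_mxM QP map_mx1.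
have -> : char_poly_mx (Q *m B *m P)
    = map_mx polyC Q *m char_poly_mx B *m map_mx polyC P.
  rewrite /char_poly_mx mulmxBr mulmxBl !map_mxM; congr (_ - _).
  by rewrite scalar_mxC -mulmxA QPp mulmx1.
by rewrite !det_mulmx mulrAC -det_mulmx QPp det1 mul1r.
Qed.

Section RealSymmetric.
Local Open Scope complex_scope.
Local Open Scope sesquilinear_scope.
Context (R : realType) (n : nat) (A : 'M[R]_n).
Hypothesis A_sym : A^T = A.

Let C : numClosedFieldType := R[i].

Lemma symmetric_unitary_diag : exists (P : 'M[C]_n) (d : 'rV[R]_n),
  P ^t* *m P = 1%:M /\ map_mx (real_complex R) A = P ^t* *m diag_mx (map_mx (real_complex R) d) *m P.
Proof.
set AC := map_mx _ A.
have AC_herm : AC \is hermsymmx.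
  apply: realsym_hermsym.
    by apply/is_hermitianmxP; rewrite expr0 scale1r map_mx_id // /AC map_trmx A_sym.
  by apply/mxOverP => i j; rewrite mxE; apply/complex_realP; exists (A i j).
exists (spectralmx AC), (map_mx (@complex.Re R) (spectral_diag AC)).
have U := spectral_unitarymx AC.
rewrite -invmx_unitary // mulVmx ?spectral_unit //; split => //.
have -> : map_mx (real_complex R) (map_mx (@complex.Re R) (spectral_diag AC)) = spectral_diag AC.
  apply/matrixP => i j; rewrite !mxE RRe_real //.
  by have /mxOverP := hermitian_spectral_diag_real AC_herm.
by apply/orthomx_spectralP/hermitian_normalmx.
Qed.

(* Entrywise real parts of a Hermitian positive semidefinite matrix: this stays
   positive semidefinite and only gets closer to the real matrix A, so no real
   eigenbasis is needed. *)
Lemma psd_approximation (sg : R) (f : R -> R) : (forall x, 0 <= f x) ->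
  exists M : 'I_n -> 'I_n -> R, [/\ forall i j, M i j = M j i, psd R 'I_n M
    & \sum_i \sum_j (A i j - sg * M i j) ^+ 2
      <= \sum_(l <- real_eigenvalues A) (l - sg * f l) ^+ 2].
Proof.
move=> f_ge0; have [P [d [PP AE]]] := symmetric_unitary_diag.
have perm_d : perm_eq (real_eigenvalues A) [seq d 0 k | k : 'I_n].
  apply: perm_real_eigenvalues.
  apply: (map_poly_inj (real_complex R)).
  rewrite map_char_poly AE char_poly_conj // char_poly_trig ?diag_mx_is_trig //.
  rewrite map_prod_XsubC big_map big_enum /=.
  by apply: eq_bigr => k _; rewrite !mxE eqxx.
pose re k i := complex.Re (P k i); pose im k i := complex.Im (P k i).
exists (fun i j => \sum_k f (d 0 k) * (re k i * re k j + im k i * im k j)); split.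
- by move=> i j; apply: eq_bigr => k _; ring.
- move=> w.
  have -> : \sum_i \sum_j w i * w j *
        (\sum_k f (d 0 k) * (re k i * re k j + im k i * im k j))
      = \sum_k f (d 0 k) * ((\sum_i w i * re k i) ^+ 2 + (\sum_i w i * im k i) ^+ 2).
    under eq_bigr do under eq_bigr do rewrite mulr_sumr.
    under eq_bigr do rewrite exchange_big.
    rewrite exchange_big /=; apply: eq_bigr => k _.
    rewrite !expr2 !big_distrlr /= -big_split mulr_sumr /=; apply: eq_bigr => i _.
    rewrite -big_split mulr_sumr /=; apply: eq_bigr => j _; ring.
  by apply: sumr_ge0 => k _; rewrite mulr_ge0 // addr_ge0 ?sqr_ge0.
pose g : 'rV[R]_n := \row_k (d 0 k - sg * f (d 0 k)).
pose X : 'M[C]_n := P ^t* *m diag_mx (map_mx (real_complex R) g) *m P.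
rewrite (perm_big _ perm_d) /= big_map big_enum /=.
rewrite -lecR !rmorph_sum /=.
have entry i j : A i j - sg * (\sum_k f (d 0 k) * (re k i * re k j + im k i * im k j))
    = complex.Re (X i j).
  have diagE (e : 'rV[R]_n) : complex.Re ((P ^t* *m diag_mx (map_mx (real_complex R) e) *m P) i j)
      = \sum_k e 0 k * (re k i * re k j + im k i * im k j).
    rewrite -mulmxA mxE (big_morph (@complex.Re R) (id1 := 0) (op1 := +%R)) //; last by case=> ? ? [].
    apply: eq_bigr => k _; rewrite mul_diag_mx !mxE /re /im.
    by case: (P k i) => a b; case: (P k j) => a' b' /=; ring.
  have -> : A i j = complex.Re (map_mx (real_complex R) A i j) by rewrite mxE.
  rewrite AE !diagE mulr_sumr -sumrB; apply: eq_bigr => k _.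
  by rewrite !mxE; ring.
have trX : \tr (X *m X ^t*) = \sum_k ((g 0 k) ^+ 2)%:C.
  have XX : X ^t* = X.
    rewrite /X !trmx_mul !map_mxM trmxCK tr_diag_mx map_diag_mx mulmxA.
    congr (_ *m diag_mx _ *m _); apply/matrixP => i k.
    by rewrite !mxE; apply/CrealP/complex_realP; exists (d 0 k - sg * f (d 0 k)).
  rewrite XX /X mxtrace_mulC !mulmxA mxtrace_mulC !mulmxA (mulmx1C PP) mul1mx.
  rewrite -!mulmxA [P *m _]mulmxA (mulmx1C PP) mul1mx mulmx_diag mxtrace_diag.
  by apply: eq_bigr => k _; rewrite !mxE -rmorphM expr2.
apply: (@le_trans _ _ (\tr (X *m X ^t*))).
  apply: ler_sum => i _; rewrite rmorph_sum /= mxE; apply: ler_sum => j _.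
  have -> : (X ^t*) j i = Num.conj (X i j) by move: (X) => Y; rewrite !mxE.
  by rewrite entry -normCK -add_Re2_Im2 lecR lerDl sqr_ge0.
by rewrite trX; apply: ler_sum => k _; rewrite mxE.
Qed.
End RealSymmetric.

(** * From spectra back to graphs *)

Lemma order_le_sum_eigenvalues (R : realType) (G : sgraph) (sg : R) (f : R -> R) :
  sg ^+ 2 = 1 -> (forall x, 0 <= f x) -> (1 < clique_number G)%N ->
  17 * (independence_number G * clique_number G)%:R <= #|G|%:R :> R ->
  #|G|%:R <= \sum_(l <- adj_eigenvalues R G) (l - sg * f l) ^+ 2.
Proof.
move=> sg2 f_ge0 omega2 alpha_omega.
have A_sym : (adjacency_mx R G)^T = adjacency_mx R G.
  by apply/matrixP => i j; rewrite !mxE adj_sym.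
have [M [M_sym M_psd M_dist]] := psd_approximation R _ _ A_sym sg f f_ge0.
apply: le_trans M_dist.
pose N (x y : G) := M (enum_rank x) (enum_rank y).
have N_psd : psd R G N.
  move=> w; have := M_psd (fun i => w (enum_val i)).
  rewrite (reindex _ (onW_bij _ (@enum_rank_bij G))) /=.
  congr (0 <= _); apply: eq_bigr => x _.
  rewrite (reindex _ (onW_bij _ (@enum_rank_bij G))) /=.
  by apply: eq_bigr => y _; rewrite !enum_rankK.
have N_sym x y : N x y = N y x by apply: M_sym.
apply: le_trans (dist_psd_ge R G N sg N_sym N_psd sg2 omega2 alpha_omega) _.
rewrite [leRHS](reindex _ (onW_bij _ (@enum_rank_bij G))) /=.
apply: ler_sum => x _; rewrite [leRHS](reindex _ (onW_bij _ (@enum_rank_bij G))) /=.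
by apply: ler_sum => y _; rewrite mxE !enum_rankK.
Qed.

(** The first edge of a path between two distinct vertices is a clique. *)
Lemma clique_number_gt1 (G : sgraph) :
  connected_graph G -> (1 < #|G|)%N -> (1 < clique_number G)%N.
Proof.
move=> G_conn /card_gt1P[x [y [_ _ xy]]].
have [[|z p] /= hp yE] := connectP (G_conn x y); first by rewrite yE eqxx in xy.
case/andP: hp => xz _.
have xz_neq : x != z by apply/negP => /eqP E; rewrite E adj_irrefl in xz.
rewrite -[2%N](_ : #|[set x; z]| = 2%N); last by rewrite cards2 xz_neq.
rewrite /clique_number leq_bigmax_cond //.
apply/forallP=> a; apply/implyP; rewrite !inE => ha.
apply/forallP=> b; apply/implyP; rewrite !inE => hb; apply/implyP => ab.
move: ha hb ab => /orP[] /eqP-> /orP[] /eqP->; rewrite ?eqxx // => _.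
by rewrite adj_sym.
Qed.

Theorem theorem8p1 (R : realType) (G : sgraph) (n : nat)
    (order_G : #|G| = n)
    (G_connected : connected_graph G)
    (alpha_omega :
       (independence_number G * clique_number G)%:R <= (1 / 17) * n%:R :> R) :
  n%:R <= Num.min (s_plus R G) (s_minus R G).
Proof.
have alpha_omega17 :
    17 * (independence_number G * clique_number G)%:R <= #|G|%:R :> R.
  by rewrite order_G; lra.
have [n0|n_gt0] := posnP n.
  by rewrite n0 le_min !sumr_ge0 // => l _; apply: sqr_ge0.
(* A single vertex already gives [alpha omega >= 1], hence at least 17 vertices. *)
have omega2 : (1 < clique_number G)%N.
  apply: clique_number_gt1 => //.
  have /card_gt0P[x _] : (0 < #|G|)%N by rewrite order_G.
  have pos (P : pred {set G}) : P [set x] -> (0 < \max_(S | P S) #|S|)%N.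
    by move=> Px; apply: leq_trans (leq_bigmax_cond _ Px); rewrite cards1.
  have : (0 < independence_number G * clique_number G)%N.
    rewrite muln_gt0 !pos //; apply/forallP=> y; apply/implyP; rewrite inE => /eqP->;
      apply/forallP=> w; apply/implyP; rewrite inE => /eqP->;
      by rewrite ?eqxx ?adj_irrefl.
  move: alpha_omega17; rewrite -natrM ler_nat => h1 h2.
  by apply: leq_trans h1; apply: leq_trans (leq_mul (leqnn 17) h2).
rewrite -order_G le_min; apply/andP; split.
  (* Here [l - sg * f l] is the positive part of [l]; the choice for [s_minus] leaves
     [min(l, 0)]. *)
  apply: le_trans (order_le_sum_eigenvalues R G (-1) (fun l => Num.max 0 (- l))
    _ _ omega2 alpha_omega17) _.
  - by rewrite sqrrN expr1n.
  - by move=> l; rewrite le_max lexx.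
  rewrite /s_plus [leRHS]big_mkcond; apply: ler_sum => l _ /=.
  by case: (ltrP 0 l) => hl; case: (lerP 0 (- l)) => hl'; nra.
apply: le_trans (order_le_sum_eigenvalues R G 1 (fun l => Num.max 0 l)
  _ _ omega2 alpha_omega17) _.
- by rewrite expr1n.
- by move=> l; rewrite le_max lexx.
rewrite /s_minus [leRHS]big_mkcond; apply: ler_sum => l _ /=.
by case: (ltrP l 0) => hl; case: (lerP 0 l) => hl'; nra.
Qed.
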